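(* Let $P, Q$ be two cumulative distribution functions on $\mathbb{R}$ satisfying Assumption 0 (defined in the context), with pdfs $p, q$ and supports $[c_P,+\infty)$ and $[c_Q,+\infty)$ respectively. Suppose that $P$ has no atom (i.e. its starting mass is $p_0=0$) and that $c_Q \ge c_P \ge -\infty$. Let $q_0 = Q(\{c_Q\})$ be the starting mass of $Q$, and define the Stein discrepancy $$\Delta(Q\mid P) := \int_{c_Q}^{+\infty} \left| 1 - \frac{r_P(x)}{r_Q(x)} \right| q(x)\, dx \in [0,+\infty].$$ Then $$\mathrm{Kol}(P,Q) \le \Delta(Q\mid P) + q_0 \qquad\text{and}\qquad \mathrm{TV}(P,Q) \le 2\,\Delta(Q\mid P) + q_0 .$$
   Context: Assumption 0 for a cumulative distribution function (cdf) $F$ on $\mathbb{R}$: there exist a starting mass $f_0 \ge 0$, a left endpoint $c_F \in [-\infty,+\infty)$, and an integrable function $f:\mathbb{R}\to[0,+\infty)$ such that $F(x) = 0$ for $x < c_F$ and $F(x) = f_0 + \int_{c_F}^x f(u)\,du$ for $x \ge c_F$; moreover $f$ is continuous and strictly positive on $(c_F,+\infty)$. The function $f$ is called the pdf of $F$, and $[c_F,+\infty)$ its support. Thus $F$ may have a single atom, of mass $f_0$, at $c_F$, and $f_0=0$ if $c_F=-\infty$. Reverse hazard rate: for $F$ satisfying Assumption 0 with pdf $f$, $r_F(x) = \frac{f(x)}{F(x)}\,\mathbb{I}_{(c_F,+\infty)}(x)$, where $\mathbb{I}_A$ is the indicator function of $A$. Distances: for a cdf $F$ and a test function $h$, $F(h)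 = \int_{\mathbb{R}} h\, dF$. Then $\mathrm{Kol}(P,Q) = \sup_{z\in\mathbb{R}} |P(\mathbb{I}_{(-\infty,z]}) - Q(\mathbb{I}_{(-\infty,z]})|$, and $\mathrm{TV}(P,Q) = \sup_{B} |P(\mathbb{I}_B) - Q(\mathbb{I}_B)|$, the supremum being over all Borel sets $B\subseteq\mathbb{R}$. *)

(* Defs.v *)
From mathcomp Require Import all_boot all_order all_algebra.
From mathcomp Require Import all_classical all_reals all_analysis.

Set Implicit Arguments.
Unset Strict Implicit.
Unset Printing Implicit Defensive.

Import Order.TTheory GRing.Theory Num.Theory.
Import numFieldNormedType.Exports.

Local Open Scope classical_set_scope.
Local Open Scope ring_scope.

(* A cdf on R is a [cumulativeBounded 0 1]: a nondecreasing, right-continuous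
   function R -> R with limits 0 at -oo and 1 at +oo. *)

Section Cdf.
Context {R : realType}.
Implicit Types (F P Q : cumulativeBounded (0 : R) (1 : R)) (c : \bar R).
Local Notation mu := (@lebesgue_measure R).

(* The starting mass is not required to vanish when [c = -oo]: this follows
   from [F x --> 0] as [x --> -oo]. *)
Record assumption0 F (f0 : R) c (f : R -> R) : Prop := Assumption0 {
  start_mass_ge0 : 0 <= f0 ;
  left_endpoint_lty : (c < +oo)%E ;
  pdf_ge0 : forall x, 0 <= f x ;
  pdf_integrable : mu.-integrable [set: R] (EFin \o f) ;
  cdf_left : forall x, (x%:E < c)%E -> F x = 0 ;
  cdf_right : forall x, (c <= x%:E)%E ->
    (F x)%:E =
      (f0%:E + \int[mu]_(u in [set u : R | c < u%:E <= x%:E]) (f u)%:E)%E ;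
  pdf_continuous : forall x, (c < x%:E)%E -> {for x, continuous f} ;
  pdf_gt0 : forall x, (c < x%:E)%E -> 0 < f x
}.

Definition rev_hazard F c (f : R -> R) (x : R) : R :=
  f x / F x * \1_[set u : R | (c < u%:E)%E] x.

Definition cdf_integral F (h : R -> R) : \bar R :=
  (\int[lebesgue_stieltjes_measure F]_x (h x)%:E)%E.

Definition Kol P Q : \bar R :=
  ereal_sup [set (`|cdf_integral P \1_`]-oo, z] - cdf_integral Q \1_`]-oo, z]|)%E
            | z in [set: R]].

Definition TV P Q : \bar R :=
  ereal_sup [set (`|cdf_integral P \1_B - cdf_integral Q \1_B|)%E
            | B in [set B : set (measurableTypeR R) | measurable B]].

(* On the domain of integration [rev_hazard Q cQ q x > 0], so that the quotient
   is a genuine one. *)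
Definition stein_discrepancy Q cQ q P cP p : \bar R :=
  (\int[mu]_(x in [set x : R | cQ < x%:E])
     (`|1 - rev_hazard P cP p x / rev_hazard Q cQ q x| * q x)%:E)%E.

End Cdf.

(* Main.v *)
(* The Stein discrepancy is Delta = int_{cQ}^oo |h| with h = q - p Q / P, and h / P
   is the derivative of Q / P, which tends to 1 at +oo. Hence
   |1 - Q(x) / P(x)| <= int_x^oo |h| / P. Multiplying by P(x) <= P(t) for t >= x
   gives |P(x) - Q(x)| <= Delta for x > cQ, which yields the Kolmogorov bound.
   For total variation, q - p = h - p (1 - Q / P), and by Tonelli
     int p(x) int_x^oo |h(t)| / P(t) dt dx = int |h(t)| / P(t) int_{cQ}^t p dt
   is at most Delta, so that int_{cQ}^oo |q - p| <= 2 Delta. *)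
From HB Require Import structures.
Require Import Defs.
From mathcomp Require Import all_boot all_order all_algebra.
From mathcomp Require Import all_classical all_reals all_analysis.
From mathcomp Require Import measurable_realfun ring lra.

Set Implicit Arguments.
Unset Strict Implicit.
Unset Printing Implicit Defensive.

Import Order.TTheory GRing.Theory Num.Theory.
Import numFieldNormedType.Exports.

Local Open Scope classical_set_scope.
Local Open Scope ring_scope.

(** * Open right rays with an extended real endpoint *)

Section RightRay.
Context {R : realType}.
Implicit Types (c : \bar R) (x : R).

Definition right_ray c : set R := [set x | (c < x%:E)%E].

(* At c = +oo the value is junk. *)
Definition ray_bound c : itv_bound R :=
  if c is r%:E then BRight r else BInfty R true.

Lemma ray_boundE c x : (c < +oo)%E ->
  (ray_bound c < BRight x)%E = (c < x%:E)%E.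
Proof. by case: c => [r||]//= _; rewrite ?lte_fin ?ltNyr. Qed.

Lemma ray_itv c x : (c < +oo)%E ->
  [set u : R | (c < u%:E <= x%:E)%E] = [set` Interval (ray_bound c) (BRight x)].
Proof.
by case: c => [r||]//= _; apply/seteqP; split => u;
  rewrite /= in_itv/= ?lte_fin ?lee_fin ?ltNyr.
Qed.

Lemma open_right_ray c : open (right_ray c).
Proof.
case: c => [r||].
- rewrite (_ : right_ray _ = [set x | r < x]); first exact: open_gt.
  by apply/seteqP; split => u; rewrite /right_ray/= lte_fin.
- rewrite (_ : right_ray _ = set0); first exact: open0.
  by apply/seteqP; split => u; rewrite /right_ray//=.
- rewrite (_ : right_ray _ = setT); first exact: openT.
  by apply/seteqP; split => u; rewrite /right_ray//= ltNyr.
Qed.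

Lemma measurable_right_ray c : measurable (right_ray c).
Proof. by apply: open_measurable; exact: open_right_ray. Qed.

Lemma right_ray_le c x y : right_ray c x -> x <= y -> right_ray c y.
Proof.
by rewrite /right_ray/= => cx xy; rewrite (lt_le_trans cx)// lee_fin.
Qed.

End RightRay.

(** * Measures given by a nonnegative density *)

Section DensityMeasure.
Context d (T : measurableType d) (R : realType).
Variables (mu : {measure set T -> \bar R}) (f : T -> \bar R).
Hypotheses (mf : measurable_fun setT f) (f0 : forall x, (0 <= f x)%E).

(** The two proofs are arguments so that the measure structure declared below can be inferred from
    the term itself. *)
Definition density_measure of measurable_fun setT f & (forall x, (0 <= f x)%E)
  : set T -> \bar R := fun A => (\int[mu]_(x in A) f x)%E.

Let nu := density_measure mf f0.

Let nu0 : nu set0 = 0%E. Proof. exact: integral_set0. Qed.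

Let nu_ge0 A : (0 <= nu A)%E. Proof. exact: integral_ge0. Qed.

Let nu_sigma : semi_sigma_additive nu.
Proof. exact: semi_sigma_additive_nng_induced. Qed.

HB.instance Definition _ := isMeasure.Build _ _ _ nu nu0 nu_ge0 nu_sigma.

End DensityMeasure.

(** * Derivative, positivity and Stieltjes measure of a cdf under Assumption 0 *)

Section Assumption0.
Context {R : realType} (F : cumulativeBounded (0 : R) (1 : R)).
Variables (f0 : R) (c : \bar R) (f : R -> R).
Hypothesis hF : assumption0 F f0 c f.
Local Notation mu := (@lebesgue_measure R).
Local Notation muF := (lebesgue_stieltjes_measure F).

Lemma stieltjes_itvNyc (z : R) : muF `]-oo, z] = (F z)%:E.
Proof.
by rewrite -cdf_lebesgue_stieltjes_id /cdf/= /distribution/= /pushforward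
  preimage_id.
Qed.

Lemma stieltjes_itvoc (a b : R) : a <= b -> muF `]a, b] = (F b - F a)%:E.
Proof.
move=> ab.
by rewrite /lebesgue_stieltjes_measure /measure_extension/= measurable_mu_extE/=
  ?wlength_itv_bnd//; exact: is_ocitv.
Qed.

Lemma cdf_integral_indic (B : set (measurableTypeR R)) : measurable B ->
  cdf_integral F \1_B = muF B.
Proof. by move=> mB; rewrite /cdf_integral integral_indic// setIT. Qed.

Lemma pdf_measurable : measurable_fun setT f.
Proof. by apply/measurable_EFinP; have /integrableP[] := pdf_integrable hF. Qed.

Lemma bounded_cumulative_ge0 x : 0 <= F x.
Proof. by rewrite -lee_fin -stieltjes_itvNyc. Qed.

(** First fundamental theorem of calculus at a continuity point of [f]: on the ray, [F] is the
    constant [f0] plus the primitive [I]. *)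
Lemma cdf_is_derive x : right_ray c x -> is_derive x 1 F (f x).
Proof.
move=> cx; have clty := left_endpoint_lty hF.
pose I y := (\int[mu]_(t in [set` Interval (ray_bound c) (BRight y)]) f t)%R.
have intf y :
    mu.-integrable [set` Interval (ray_bound c) (BRight y)] (EFin \o f).
  exact: integrableS (pdf_integrable hF).
have [dI I'] : derivable I x 1 /\ derive1 I x = f x.
  (* [x + 1] is an arbitrary point beyond [x], up to which [f] has to be integrable. *)
  apply: (@continuous_FTC1 _ _ _ _ (x + 1)) => //.
  - by rewrite ltrDl.
  - by rewrite ray_boundE.
  - exact: pdf_continuous hF _ cx.
have : is_derive x 1 (cst f0 + I) (f x).
  rewrite -[f x]add0r -I' derive1E.
  by apply: is_deriveD; exact/derivableP.
(* The formula for [F] holds only on the ray; the ray is open, so it holds near [x]. *)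
apply: near_eq_is_derive; near=> y.
have cy : right_ray c y.
  by near: y; apply: open_nbhs_nbhs; split => //; exact: open_right_ray.
apply/esym/EFin_inj; rewrite (cdf_right hF (ltW cy)) EFinD ray_itv//.
by rewrite /I /Rintegral fineK//; exact: integrable_fin_num.
Unshelve. all: by end_near. Qed.

Lemma cdf_continuous x : right_ray c x -> {for x, continuous F}.
Proof.
move=> cx; apply: differentiable_continuous; apply/derivable1_diffP.
by have [] := cdf_is_derive cx.
Qed.

(* If F vanished at x it would vanish to the left of x, against F' = f > 0. *)
Lemma cdf_gt0 x : right_ray c x -> 0 < F x.
Proof.
move=> cx; rewrite ltNge; apply/negP => Fx0.
near x^'- => y.
have yx : y < x by near: y; exact: nbhs_left_lt.
have cy : right_ray c y.
  near: y; apply: cvg_within; apply: open_nbhs_nbhs; split => //.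
  exact: open_right_ray.
have [_ ] := cdf_is_derive cy.
have -> : 'D_1 F y = 'D_1 (cst 0 : R -> R) y.
  apply: near_eq_derive; near=> z.
  apply/eqP; rewrite eq_le bounded_cumulative_ge0 andbT.
  apply: le_trans Fx0; apply: cumulative_is_nondecreasing.
  by apply/ltW; near: z; exact: lt_nbhsl.
rewrite derive_cst => f0'; have := pdf_gt0 hF cy.
by rewrite -f0' ltxx.
Unshelve. all: by end_near. Qed.


(** The cdf formulas at [a] and [b] are subtracted, and [f0] cancels. The case [a = c] is included,
    for intervals that start at the endpoint. *)
Lemma cdf_increment (a b : R) : (c <= a%:E)%E -> a <= b ->
  (\int[mu]_(u in `]a, b]) (f u)%:E = (F b - F a)%:E)%E.
Proof.
move=> ca ab; have cb : (c <= b%:E)%E by rewrite (le_trans ca)// lee_fin.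
have clty := left_endpoint_lty hF.
have intf (i : interval R) : mu.-integrable [set` i] (EFin \o f).
  exact: integrableS (pdf_integrable hF).
have split_ray : [set` Interval (ray_bound c) (BRight b)] =
    [set` Interval (ray_bound c) (BRight a)] `|` `]a, b].
  by rewrite -itv_bndbnd_setU//=; case: (c) ca clty.
rewrite EFinB (cdf_right hF cb) (cdf_right hF ca) !ray_itv// split_ray.
rewrite ge0_integral_setU//=.
(* Both integrals are finite, so the subtraction takes place in [R]. *)
- rewrite -(fineK (integrable_fin_num _
    (intf (Interval (ray_bound c) (BRight a)))))//.
  rewrite -(fineK (integrable_fin_num _ (intf `]a, b])))//= -!EFinD.
  by congr EFin; ring.
- apply: measurable_funTS; apply/measurable_EFinP; exact: pdf_measurable.
- by move=> u _; rewrite lee_fin (pdf_ge0 hF).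
- apply/disj_setPLR => z/=; rewrite !in_itv/= => /andP[_ za].
  by rewrite ltNge za.
Qed.

(* Gluing f dx on (c, +oo) with the restriction of [muF] to the complement gives
   a measure that agrees with [muF] on every `]a, b]. *)
Lemma stieltjes_density (B : set (measurableTypeR R)) :
  measurable B -> B `<=` right_ray c -> (muF B = \int[mu]_(x in B) (f x)%:E)%E.
Proof.
move=> mB Bc; have clty := left_endpoint_lty hF.
have mray := measurable_right_ray c.
have mf : measurable_fun setT (fun x => (f x * \1_(right_ray c) x)%:E).
  apply/measurable_EFinP; apply: measurable_funM; first exact: pdf_measurable.
  exact: measurable_indic.
have fge0 x : (0 <= (f x * \1_(right_ray c) x)%:E)%E.
  by rewrite lee_fin mulr_ge0// (pdf_ge0 hF).
pose dens : {measure set (measurableTypeR R) -> \bar R} :=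
  @density_measure _ (measurableTypeR R) R mu _ mf fge0.
pose nu := measure_add (mrestr muF (measurableC mray)) dens.
have densE (A : set (measurableTypeR R)) : measurable A ->
    (dens A = \int[mu]_(x in A `&` right_ray c) (f x)%:E)%E.
  move=> mA; rewrite /dens/= /density_measure integral_mkcondr.
  apply: eq_integral => x _; rewrite patchE indicE.
  by case: ifPn => _; rewrite ?mulr1 ?mulr0.
have nuE (A : set (measurableTypeR R)) : measurable A ->
    nu A = (muF (A `\` right_ray c) +
            \int[mu]_(x in A `&` right_ray c) (f x)%:E)%E.
  move=> mA; rewrite /nu /measure_add/= /msum/= 2!big_ord_recl/= big_ord0 adde0.
  by rewrite densE.
transitivity (nu B); last first.
  rewrite nuE// (setIidl Bc) (_ : B `\` _ = set0) ?measure0 ?add0e//.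
  by rewrite setD_eq0.
apply: lebesgue_stieltjes_measure_unique => // X [[a b] _ <-].
rewrite -[RHS]/(nu _) nuE//=.
have [ab|ba] := leP a b; last first.
  by rewrite set_itv_ge ?bnd_simp -?leNgt ?ltW// set0D set0I !measure0
    integral_set0 adde0.
rewrite stieltjes_itvoc//.
have [ca|] := leP c a%:E.
  have abc : `]a, b] `<=` right_ray c.
    move=> u/=; rewrite in_itv/= => /andP[au _].
    by rewrite /right_ray/= (le_lt_trans ca)// lte_fin.
  rewrite (setIidl abc) (_ : `]a, b] `\` _ = set0); last by rewrite setD_eq0.
  by rewrite measure0 add0e cdf_increment.
(* Here [a < c < +oo], so the endpoint is a real number [r]. *)
case cE : c clty => [r||]//= _; rewrite lte_fin => ar.
(* If [r] lies in []a, b]], the restriction of [muF] accounts for []a, r]], with the atom, and the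
   density for []r, b]]; the two increments add up. *)
have [rb|br] := leP r b.
  have -> : `]a, b] `\` right_ray r%:E = `]a, r]%classic.
    apply/seteqP; split => u; rewrite /right_ray/= !in_itv/= lte_fin.
      by move=> [/andP[-> _] /negP]; rewrite -leNgt.
    move=> /andP[-> ur]; rewrite (le_trans ur rb); split => //.
    by apply/negP; rewrite -leNgt.
  have -> : `]a, b] `&` right_ray r%:E = `]r, b]%classic.
    apply/seteqP; split => u; rewrite /right_ray/= !in_itv/= lte_fin.
      by move=> [/andP[_ ->] ->].
    by move=> /andP[ru ->]; rewrite ru (lt_trans ar ru).
  rewrite stieltjes_itvoc ?(ltW ar)// cdf_increment ?cE//.
  by rewrite -EFinD; congr EFin; ring.
have -> : `]a, b] `\` right_ray r%:E = `]a, b]%classic.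
  apply/seteqP; split => u; rewrite /right_ray/= !in_itv/= lte_fin; first by case.
  move=> /andP[-> ub]; rewrite ub; split => //.
  by apply/negP; rewrite -leNgt (le_trans ub)// ltW.
have -> : `]a, b] `&` right_ray r%:E = set0.
  apply/seteqP; split => u//; rewrite /right_ray/= !in_itv/= lte_fin.
  by move=> [/andP[_ ub] ru]; have := lt_le_trans ru ub; rewrite ltNge (ltW br).
by rewrite integral_set0 adde0 stieltjes_itvoc.
Qed.

Lemma cdf_left_endpoint r : c = r%:E -> F r = f0.
Proof.
move=> cr; apply/EFin_inj; rewrite (cdf_right hF) cr//.
rewrite (_ : [set _ | _] = set0) ?integral_set0 ?adde0//.
apply/seteqP; split => u//=; rewrite lte_fin lee_fin => /andP[ru ur].
by have := lt_le_trans ru ur; rewrite ltxx.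
Qed.

(** For finite [c] the complement lies in []-oo, c]], of mass [F c = f0]; for [c = -oo] it is empty.
    Applied to [Q], this yields the term [q0] of the total variation bound. *)
Lemma stieltjes_setC_right_ray : (muF (~` right_ray c) <= f0%:E)%E.
Proof.
have := left_endpoint_lty hF; case cE : c => [r||]//= _.
- rewrite -(cdf_left_endpoint cE) -stieltjes_itvNyc le_measure ?inE//.
    by apply: measurableC; exact: measurable_right_ray.
  by move=> u; rewrite /right_ray/= in_itv/= lte_fin => /negP; rewrite -leNgt.
- rewrite (_ : ~` _ = set0) ?measure0 ?lee_fin ?(start_mass_ge0 hF)//.
  by apply/seteqP; split => u//; rewrite /right_ray/= ltNyr.
Qed.

End Assumption0.

(** * Tonelli's theorem on the half-plane x <= t *)

Section TailTonelli.
Context {R : realType}.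
Local Notation mu := (@lebesgue_measure R).
Local Open Scope ereal_scope.
Implicit Types f g : R -> \bar R.

(** Integrating out the second variable leaves [f] times a tail of [g], integrating out the first
    leaves [g] times a head of [f]; both orders thus come from one kernel. *)
Definition tail_kernel f g : measurableTypeR R * measurableTypeR R -> \bar R :=
  (fun z => f z.1 * g z.2) \_ [set z | z.1 <= z.2]%R.

Lemma measurable_tail_kernel f g : measurable_fun setT f ->
  measurable_fun setT g -> measurable_fun setT (tail_kernel f g).
Proof.
move=> mf mg; apply/(measurable_restrictT _ _).1.
  rewrite -[X in measurable X]setTI.
  (* The half-plane is the preimage of [true] under the comparison of the two coordinates. *)
  have := @measurable_fun_ler _ (measurableTypeR R * measurableTypeR R)%type R
    setT fst snd measurable_fst measurable_snd measurableT [set true].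
  exact.
apply: measurable_funTS; apply: emeasurable_funM.
  exact: measurableT_comp mf measurable_fst.
exact: measurableT_comp mg measurable_snd.
Qed.

Lemma tail_kernel_ge0 f g z : (forall x, 0 <= f x) -> (forall x, 0 <= g x) ->
  0 <= tail_kernel f g z.
Proof.
move=> f0 g0; rewrite /tail_kernel patchE.
by case: ifPn => // _; exact: mule_ge0.
Qed.

Lemma integral_tail_kernel_snd f g x : measurable_fun setT g ->
  (forall x, 0 <= f x) -> (forall x, 0 <= g x) ->
  \int[mu]_t tail_kernel f g (x, t) = f x * \int[mu]_(t in `[x, +oo[) g t.
Proof.
move=> mg f0 g0; rewrite -ge0_integralZl//; last exact: measurable_funTS.
rewrite [RHS]integral_mkcond; apply: eq_integral => t _.
rewrite /tail_kernel !patchE; congr (if _ then _ else _).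
by apply/idP/idP; rewrite !inE/= in_itv/= andbT.
Qed.

Lemma integral_tail_kernel_fst f g t : measurable_fun setT f ->
  (forall x, 0 <= f x) -> (forall x, 0 <= g x) ->
  \int[mu]_x tail_kernel f g (x, t) = g t * \int[mu]_(x in `]-oo, t]) f x.
Proof.
move=> mf f0 g0; rewrite -ge0_integralZl//; last exact: measurable_funTS.
rewrite [RHS]integral_mkcond; apply: eq_integral => x _.
rewrite /tail_kernel !patchE muleC; congr (if _ then _ else _).
Qed.

(** The function is a marginal of the kernel, hence measurable by Tonelli; [measurable_head] treats
    the other marginal. *)
Lemma measurable_tail f g : measurable_fun setT f -> measurable_fun setT g ->
  (forall x, 0 <= f x) -> (forall x, 0 <= g x) ->
  measurable_fun setT (fun x => f x * \int[mu]_(t in `[x, +oo[) g t).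
Proof.
move=> mf mg f0 g0.
have := measurable_fun_fubini_tonelli_F (m2 := mu) (tail_kernel f g)
  (measurable_tail_kernel mf mg) (fun z => tail_kernel_ge0 z f0 g0).
congr (measurable_fun _ _); apply/funext => x.
by rewrite /fubini_F integral_tail_kernel_snd.
Qed.

Lemma measurable_head f g : measurable_fun setT f -> measurable_fun setT g ->
  (forall x, 0 <= f x) -> (forall x, 0 <= g x) ->
  measurable_fun setT (fun t => g t * \int[mu]_(x in `]-oo, t]) f x).
Proof.
move=> mf mg f0 g0.
have := measurable_fun_fubini_tonelli_G (m1 := mu) (tail_kernel f g)
  (measurable_tail_kernel mf mg) (fun z => tail_kernel_ge0 z f0 g0).
congr (measurable_fun _ _); apply/funext => t.
by rewrite /fubini_G integral_tail_kernel_fst.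
Qed.

Lemma tail_tonelli f g : measurable_fun setT f -> measurable_fun setT g ->
  (forall x, 0 <= f x) -> (forall x, 0 <= g x) ->
  \int[mu]_x (f x * \int[mu]_(t in `[x, +oo[) g t) =
  \int[mu]_t (g t * \int[mu]_(x in `]-oo, t]) f x).
Proof.
move=> mf mg f0 g0.
have := fubini_tonelli (m1 := mu) (m2 := mu) (tail_kernel f g)
  (measurable_tail_kernel mf mg) (fun z => tail_kernel_ge0 z f0 g0).
rewrite /fubini_F /fubini_G => tonelli.
under eq_integral do rewrite -integral_tail_kernel_snd//.
by rewrite tonelli; apply: eq_integral => t _; rewrite integral_tail_kernel_fst.
Qed.

End TailTonelli.

(** * The Stein gap and the Kolmogorov bound *)

Section SteinDiscrepancy.
Context {R : realType} (P Q : cumulativeBounded (0 : R) (1 : R)).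
Variables (p0 q0 : R) (cP cQ : \bar R) (p q : R -> R).
Hypotheses (hP : assumption0 P p0 cP p) (hQ : assumption0 Q q0 cQ q).
Hypothesis hc : (cP <= cQ)%E.
Local Notation mu := (@lebesgue_measure R).
Local Notation D := (right_ray cQ).
Local Notation Delta := (stein_discrepancy Q cQ q P cP p).

(** The function h of the overview. In this form the denominator is [P] alone, and dividing by [P]
    gives the derivative of [Q / P]. *)
Definition stein_gap (x : R) : R := q x - p x * (Q x / P x).

Let D_rayP x : D x -> right_ray cP x.
Proof. exact: le_lt_trans. Qed.

Let P_gt0 x : D x -> 0 < P x.
Proof. by move=> Dx; apply: (cdf_gt0 hP); exact: D_rayP. Qed.

Let mD : measurable D. Proof. exact: measurable_right_ray. Qed.

(** On [D] the indicators are 1 and [P], [Q], [q] are positive, so [q] moves inside the absolute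
    value and cancels the denominator of the ratio of hazard rates. *)
Lemma stein_discrepancyE : Delta = (\int[mu]_(x in D) `|stein_gap x|%:E)%E.
Proof.
rewrite /stein_discrepancy; apply: eq_integral => x; rewrite inE => Dx.
have Px := P_gt0 Dx; have Qx := cdf_gt0 hQ Dx; have qx := pdf_gt0 hQ Dx.
rewrite /rev_hazard !indicE !mem_set/=; [|exact: Dx|exact: D_rayP].
rewrite !mulr1 -[X in _ * X](gtr0_norm qx) -normrM; congr (`|_|%:E).
by rewrite /stein_gap; field; rewrite !gt_eqF.
Qed.

Lemma stein_gap_continuous x : D x -> {for x, continuous stein_gap}.
Proof.
move=> Dx; have Px := P_gt0 Dx; have DPx := D_rayP Dx.
apply: (@cvgB _ R^o); first exact: pdf_continuous hQ _ Dx.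
apply: cvgM; first exact: pdf_continuous hP _ DPx.
apply: cvgM; first exact: (cdf_continuous hQ).
apply: cvgV; first by rewrite gt_eqF.
exact: (cdf_continuous hP).
Qed.

Lemma stein_ratio_is_derive x : D x ->
  is_derive x 1 (fun y => Q y / P y) (stein_gap x / P x).
Proof.
move=> Dx; have Px := P_gt0 Dx; have Px0 : P x != 0 by rewrite gt_eqF.
have [dP P'] := cdf_is_derive hP (D_rayP Dx).
have dQ := cdf_is_derive hQ Dx.
have dV : is_derive x 1 (fun y => (P y)^-1) (- (P x) ^- 2 *: p x).
  by apply: DeriveDef; [exact: derivableV|rewrite deriveV// P'].
(* The right-hand side is the shape that the product rule gives for [Q] times the inverse of [P]. *)
have -> : stein_gap x / P x = Q x *: (- (P x) ^- 2 *: p x) + (P x)^-1 *: q x.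
  by rewrite /stein_gap /GRing.scale/=; field.
exact: is_deriveM.
Qed.

Lemma stein_ratio_continuous x : D x ->
  {for x, continuous (fun y => Q y / P y)}.
Proof.
move=> Dx; apply: differentiable_continuous; apply/derivable1_diffP.
by have [] := stein_ratio_is_derive Dx.
Qed.

Let k (x : R) : R := `|stein_gap x| / P x.

Let k_continuous x : D x -> {for x, continuous k}.
Proof.
move=> Dx; have Px := P_gt0 Dx.
apply: cvgM; first by apply: cvg_norm; exact: stein_gap_continuous.
by apply: cvgV; [rewrite gt_eqF|exact: (cdf_continuous hP) (D_rayP Dx)].
Qed.

Let k_ge0 x : D x -> 0 <= k x.
Proof. by move=> Dx; rewrite divr_ge0// ltW// P_gt0. Qed.

Let mk : measurable_fun D k.
Proof.
apply: open_continuous_measurable_fun; first exact: open_right_ray.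
by move=> x; rewrite inE; exact: k_continuous.
Qed.

Let mgap : measurable_fun D (fun x => `|stein_gap x|).
Proof.
apply: open_continuous_measurable_fun; first exact: open_right_ray.
by move=> x; rewrite inE => Dx; apply: cvg_norm; exact: stein_gap_continuous.
Qed.

Let D_itvcy x : D x -> `[x, +oo[ `<=` D.
Proof.
by move=> Dx y/=; rewrite in_itv/= andbT => xy; exact: right_ray_le Dx xy.
Qed.

Lemma stein_ratio_bound x : D x ->
  (`|1 - Q x / P x|%:E <=
   \int[mu]_(t in `[x, +oo[) (`|stein_gap t| / P t)%:E)%E.
Proof.
move=> Dx; pose G y := Q y / P y.
set I := (\int[mu]_(t in `[x, +oo[) _)%E.
have I_ge0 : (0 <= I)%E.
  apply: integral_ge0 => t xt; rewrite lee_fin; apply: k_ge0.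
  exact: D_itvcy xt.
(* The second fundamental theorem on [[x, b]], with a bound [I] that does not depend on [b]. *)
have step b : x < b -> (`|G b - G x|%:E <= I)%E.
  move=> xb.
  have Dxb y : y \in `[x, b] -> D y.
    by rewrite in_itv/= => /andP[xy _]; exact: right_ray_le Dx xy.
  have cG y : y \in `[x, b] -> {for y, continuous G}.
    by move=> /Dxb; exact: stein_ratio_continuous.
  have cg : {within `[x, b], continuous (fun y => stein_gap y / P y)}.
    apply: continuous_in_subspaceT => y; rewrite inE => /Dxb Dy.
    apply: cvgM; first exact: stein_gap_continuous.
    apply: cvgV; first by rewrite gt_eqF// P_gt0.
    exact: (cdf_continuous hP) (D_rayP Dy).
  have := @continuous_FTC2 R (fun y => stein_gap y / P y) G x b xb cg.
  rewrite -EFinB => FTC.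
  rewrite -[(`|_|)%:E]/(`|(G b - G x)%:E|)%E -FTC; last 2 first.
  - split.
    + move=> y; move/subset_itv_oo_cc/Dxb => Dy.
      by have [] := stein_ratio_is_derive Dy.
    + apply: cvg_at_right_filter; apply: cG; by rewrite bound_itvE ltW.
    + apply: cvg_at_left_filter; apply: cG; by rewrite bound_itvE ltW.
  - move=> y /subset_itv_oo_cc/Dxb Dy.
    by rewrite derive1E; have [_ ->] := stein_ratio_is_derive Dy.
  apply: (le_trans (le_abse_integral _ _ _)) => //.
    apply/measurable_EFinP.
    exact: subspace_continuous_measurable_fun.
  have -> : (\int[mu]_(t in `[x, b]) `|(stein_gap t / P t)%:E|
      = \int[mu]_(t in `[x, b]) (k t)%:E)%E.
    apply: eq_integral => t; rewrite inE => /Dxb Dt.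
    by rewrite /k abse_EFin normrM normfV (gtr0_norm (P_gt0 Dt)).
  apply: ge0_subset_integral => //.
  - apply/measurable_EFinP; apply: measurable_funS mk => //.
    exact: D_itvcy.
  - by move=> t xt; rewrite lee_fin; apply: k_ge0; exact: D_itvcy xt.
  - by apply: subset_itvl.
case IE : I I_ge0 step => [i||]//= _ step; last by rewrite leey.
(* With [I] finite, [b] is taken so large that [G b] is within [e] of its limit 1. *)
rewrite lee_fin; apply/ler_addgt0Pr => e e0.
have G1 : G b @[b --> +oo] --> (1 : R).
  rewrite -[X in _ --> X]divr1; apply: cvgM; first exact: cumulativey.
  by apply: cvgV; [rewrite oner_neq0|exact: cumulativey].
near (pinfty_nbhs R) => b.
have xb : x < b by near: b; apply: nbhs_pinfty_gt; exact: num_real.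
have := step _ xb; rewrite lee_fin => Gbx.
rewrite (_ : 1 - _ = (1 - G b) + (G b - G x)); last by rewrite /G; ring.
rewrite (le_trans (ler_normD _ _))// addrC lerD//.
by near: b; move/cvgrPdist_le : G1; exact.
Unshelve. all: by end_near. Qed.

Lemma cdf_diff_bound x : D x -> (`|P x - Q x|%:E <= Delta)%E.
Proof.
move=> Dx; have Px := P_gt0 Dx.
have -> : `|P x - Q x| = P x * `|1 - Q x / P x|.
  have := normrM (P x) (1 - Q x / P x); rewrite (gtr0_norm Px) => <-.
  by congr `|_|; field; rewrite gt_eqF.
rewrite EFinM.
apply: (@le_trans _ _ ((P x)%:E * \int[mu]_(t in `[x, +oo[) (k t)%:E)%E).
  by rewrite lee_pmul2l//; exact: stein_ratio_bound.
have mk' : measurable_fun `[x, +oo[ k.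
  by apply: measurable_funS mk => //; exact: D_itvcy.
rewrite stein_discrepancyE -ge0_integralZl//; last 3 first.
- exact/measurable_EFinP.
- by move=> t xt; rewrite lee_fin; apply: k_ge0; exact: D_itvcy xt.
- by rewrite lee_fin ltW.
apply: (@le_trans _ _ (\int[mu]_(t in `[x, +oo[) `|stein_gap t|%:E)%E).
  apply: ge0_le_integral => //.
  - move=> t xt; rewrite mule_ge0 ?lee_fin ?(ltW Px)//.
    by apply: k_ge0; exact: D_itvcy xt.
  - by apply/measurable_EFinP; apply: measurable_funM.
  - apply/measurable_EFinP; apply: measurable_funS mgap => //.
    exact: D_itvcy.
  (* Monotonicity of [P] gives [P x / P t <= 1] for [x <= t]. *)
  - move=> t xt; rewrite -EFinM lee_fin /k mulrCA ler_piMr//.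
    rewrite ler_pdivrMr ?P_gt0 ?mul1r//; last exact: D_itvcy xt.
    by apply: cumulative_is_nondecreasing; move: xt; rewrite /= in_itv/= andbT.
apply: ge0_subset_integral => //; first exact/measurable_EFinP.
exact: D_itvcy.
Qed.

(* The bound on (cQ, +oo) extends to cQ by right-continuity, and to the left of
   cQ since there Q = 0 and P <= P(cQ). *)
Lemma cdf_diff_bound_left x : (x%:E <= cQ)%E ->
  (`|P x - Q x|%:E <= Delta + q0%:E)%E.
Proof.
move=> xc; have q00 := start_mass_ge0 hQ.
have [r cQE] : exists r, cQ = r%:E.
  exists (fine cQ); rewrite fineK// fin_numElt (left_endpoint_lty hQ) andbT.
  exact: lt_le_trans (ltNyr x) xc.
have xr : x <= r by rewrite -lee_fin -cQE.
have Dr y : r < y -> right_ray cQ y by rewrite /right_ray/= cQE lte_fin.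
have Delta_ge0 : (0 <= Delta)%E.
  by rewrite stein_discrepancyE; apply: integral_ge0 => t _; rewrite lee_fin.
have Pr : (`|P r - Q r|%:E <= Delta)%E.
  case DE : Delta Delta_ge0 => [e||]//= e0; last by rewrite leey.
  rewrite lee_fin.
  have PQr : `|P y - Q y| @[y --> r^'+] --> `|P r - Q r|.
    by apply: cvg_norm; apply: cvgB; exact: cumulative_is_right_continuous.
  (* Points [y > r] lie in [D], where the bound is known, and it survives the limit from the
     right. *)
  apply: (cvgr_to_le PQr); near=> y.
  rewrite -lee_fin -DE; apply: cdf_diff_bound; apply: Dr.
  by near: y; exact: nbhs_right_gt.
have [->|xr'] := eqVneq x r.
  by rewrite (le_trans Pr)// leeDl// lee_fin.
have xlr : x < r by rewrite lt_neqAle xr' xr.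
have Qr := cdf_left_endpoint hQ cQE.
have Qx : Q x = 0 by apply: (cdf_left hQ); rewrite cQE lte_fin.
rewrite Qx subr0 ger0_norm ?bounded_cumulative_ge0//.
apply: (@le_trans _ _ (`|P r - Q r|%:E + q0%:E)%E); last exact: leeD.
(* Since [Q r = q0], [P x <= P r = (P r - Q r) + q0]. *)
rewrite -EFinD lee_fin; apply: (@le_trans _ _ (P r)).
  exact: cumulative_is_nondecreasing.
by rewrite -lerBlDr -Qr ler_norm.
Unshelve. all: by end_near. Qed.

(** On half-lines the measures are the cdf values, so the two pointwise bounds cover every [z]; [q0]
    is spent only when [z <= cQ]. *)
Lemma Kol_bound : (Kol P Q <= Delta + q0%:E)%E.
Proof.
apply: ge_ereal_sup => _ [z _ <-].
rewrite !cdf_integral_indic// !stieltjes_itvNyc -EFinB abse_EFin.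
have [Dz|zc] := ltP cQ z%:E; last exact: cdf_diff_bound_left.
rewrite (le_trans (cdf_diff_bound Dz))// leeDl// lee_fin.
exact: start_mass_ge0 hQ.
Qed.

(** * The total variation bound *)

Let f (x : R) : \bar R := ((EFin \o p) \_ D) x.
(** Like [f], extended by zero outside [D]: Tonelli can then be applied on the whole line, while
    only points with [P > 0] contribute. *)
Let g (x : R) : \bar R := ((EFin \o k) \_ D) x.

Let mf : measurable_fun setT f.
Proof.
apply/(measurable_restrictT _ _).1 => //; apply: measurable_funTS.
by apply/measurable_EFinP; exact: (pdf_measurable hP).
Qed.

Let mg : measurable_fun setT g.
Proof. by apply/(measurable_restrictT _ _).1 => //; apply/measurable_EFinP. Qed.

Let f_ge0 x : (0 <= f x)%E.
Proof. by apply: erestrict_ge0 => y _ /=; rewrite lee_fin (pdf_ge0 hP). Qed.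

Let g_ge0 x : (0 <= g x)%E.
Proof. by apply: erestrict_ge0 => y Dy /=; rewrite lee_fin k_ge0. Qed.

(** As [cP <= cQ], the part of [D] up to [t] lies in [(cP, t]], over which the integral of [p] is
    [P t - p0]. *)
Let integral_f_le t : D t -> (\int[mu]_(x in `]-oo, t]) f x <= (P t)%:E)%E.
Proof.
move=> Dt; have cPt : (cP <= t%:E)%E by apply/ltW; exact: D_rayP.
rewrite (cdf_right hP cPt) /f -integral_mkcondr.
apply: (@le_trans _ _
    (\int[mu]_(u in [set u : R | (cP < u%:E <= t%:E)%E]) (p u)%:E)%E).
  rewrite ray_itv ?(left_endpoint_lty hP)//.
  apply: ge0_subset_integral => //.
  - exact: measurableI.
  - by apply: measurable_funTS; apply/measurable_EFinP; exact: (pdf_measurable hP).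
  - by move=> x _; rewrite lee_fin (pdf_ge0 hP).
  - rewrite -ray_itv ?(left_endpoint_lty hP)// => x [/=].
    rewrite in_itv/= => xt Dx.
    by rewrite lee_fin xt andbT; exact: D_rayP.
by rewrite leeDr// lee_fin (start_mass_ge0 hP).
Qed.

Let integral_tail_le :
  (\int[mu]_x (f x * \int[mu]_(t in `[x, +oo[) g t) <= Delta)%E.
Proof.
rewrite tail_tonelli// stein_discrepancyE [leRHS]integral_mkcond.
apply: ge0_le_integral => //.
- by move=> t _; rewrite mule_ge0// integral_ge0.
- exact: measurable_head.
- by apply/(measurable_restrictT _ _).1 => //; apply/measurable_EFinP.
move=> t _; rewrite /g !patchE; case: ifPn => [|_]; last by rewrite mul0e.
rewrite inE => Dt.
(* The head integral of [f] is at most [P t], which is exactly the denominator of [k t]. *)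
apply: (@le_trans _ _ ((k t)%:E * (P t)%:E)%E).
  by apply: lee_wpmul2l; [rewrite lee_fin k_ge0|exact: integral_f_le].
by rewrite -EFinM /k divfK// gt_eqF// P_gt0.
Qed.

Lemma pdf_diff_bound :
  (\int[mu]_(x in D) `|q x - p x|%:E <= 2%:E * Delta)%E.
Proof.
have mdiff : measurable_fun D (fun x => p x * `|1 - Q x / P x|).
  apply: open_continuous_measurable_fun; first exact: open_right_ray.
  move=> x; rewrite inE => Dx; apply: cvgM.
    exact: pdf_continuous hP _ (D_rayP Dx).
  apply: cvg_norm; apply: cvgB; first exact: cvg_cst.
  exact: stein_ratio_continuous.
apply: (@le_trans _ _
    (\int[mu]_(x in D) (`|stein_gap x|%:E + (p x * `|1 - Q x / P x|)%:E))%E).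
  apply: ge0_le_integral => //.
  - apply/measurable_EFinP; apply: measurableT_comp => //.
    by apply: measurable_funB; apply: measurable_funTS;
      [exact: (pdf_measurable hQ)|exact: (pdf_measurable hP)].
  - by apply: emeasurable_funD; exact/measurable_EFinP.
  - move=> x Dx; rewrite -EFinD lee_fin -[X in X * _]ger0_norm ?(pdf_ge0 hP)//.
    rewrite -normrM.
    have -> : q x - p x = stein_gap x - p x * (1 - Q x / P x).
      by rewrite /stein_gap; ring.
    exact: ler_normB.
rewrite ge0_integralD//; last 3 first.
- exact/measurable_EFinP.
- by move=> x _; rewrite lee_fin mulr_ge0// (pdf_ge0 hP).
- exact/measurable_EFinP.
(* The gap contributes the first [Delta]; the second comes from [p * |1 - Q / P|], dominated
   pointwise by [f] times the tail of [g]. *)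
rewrite -stein_discrepancyE mule_natl mule2n leeD2l//.
apply: le_trans integral_tail_le.
rewrite integral_mkcond; apply: ge0_le_integral => //.
- move=> x _; apply: erestrict_ge0 => y _ /=.
  by rewrite lee_fin mulr_ge0// (pdf_ge0 hP).
- by apply/(measurable_restrictT _ _).1 => //; apply/measurable_EFinP.
- exact: measurable_tail.
move=> x _; rewrite /f !patchE; case: ifPn => [|_]; last by rewrite mul0e.
rewrite inE => Dx; rewrite EFinM lee_pmul2l ?lte_fin ?(pdf_gt0 hP)//;
  last exact: D_rayP.
rewrite (le_trans (stein_ratio_bound Dx))//.
rewrite [leRHS](_ : _ = \int[mu]_(t in `[x, +oo[) (k t)%:E)%E//.
apply: eq_integral => t; rewrite inE => xt.
by rewrite /g patchE mem_set//; exact: D_itvcy xt.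
Qed.

(* A one-sided bound suffices for TV: the other side is this one for the
   complement of B. Bounding P B - Q B directly would cost a further Delta, from
   the mass of P on (-oo, cQ]. *)
Lemma stieltjes_le (B : set (measurableTypeR R)) : measurable B ->
  (lebesgue_stieltjes_measure Q B <=
   lebesgue_stieltjes_measure P B + (2%:E * Delta + q0%:E))%E.
Proof.
move=> mB; have mBD : measurable (B `&` D) by exact: measurableI.
have mBD' : measurable (B `\` D) by exact: measurableD.
(* Inside [D] both measures have densities to compare; outside [D] the mass of [Q] is at most
   [q0]. *)
rewrite -{1}(setUIDK B D) measureU//; last first.
  by rewrite setDE setIACA setICr setI0.
rewrite addeA; apply: leeD; last first.
  apply: le_trans (stieltjes_setC_right_ray hQ).
  by rewrite le_measure ?inE//; exact: measurableC.
have mp : measurable_fun (B `&` D) (EFin \o p).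
  by apply: measurable_funTS; apply/measurable_EFinP; exact: (pdf_measurable hP).
have mqp : measurable_fun D (fun x => `|q x - p x|%:E).
  apply/measurable_EFinP; apply: measurableT_comp => //.
  by apply: measurable_funB; apply: measurable_funTS;
    [exact: (pdf_measurable hQ)|exact: (pdf_measurable hP)].
have mqpB : measurable_fun (B `&` D) (fun x => `|q x - p x|%:E).
  by apply: measurable_funS mqp.
apply: (@le_trans _ _
    (lebesgue_stieltjes_measure P (B `&` D) + 2%:E * Delta)%E);
  last by apply: leeD => //; rewrite le_measure ?inE.
have BDP : B `&` D `<=` right_ray cP by move=> x [_] /D_rayP.
rewrite [leLHS](stieltjes_density hQ mBD (@subIsetr _ _ _)).
rewrite [X in (_ <= X + _)%E](stieltjes_density hP mBD BDP).
(* Pointwise, [q <= p + |q - p|]. *)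
apply: (@le_trans _ _
    (\int[mu]_(x in B `&` D) ((p x)%:E + `|q x - p x|%:E))%E).
  apply: ge0_le_integral => //.
  - by move=> x _; rewrite lee_fin (pdf_ge0 hQ).
  - by apply: measurable_funTS; apply/measurable_EFinP; exact: (pdf_measurable hQ).
  - exact: emeasurable_funD.
  - by move=> x _; rewrite -EFinD lee_fin -lerBlDl ler_norm.
rewrite ge0_integralD//; last by move=> x _; rewrite lee_fin (pdf_ge0 hP).
rewrite leeD2l//; apply: le_trans pdf_diff_bound.
exact: ge0_subset_integral.
Qed.

Lemma TV_bound : (TV P Q <= 2%:E * Delta + q0%:E)%E.
Proof.
apply: ge_ereal_sup => _ [B mB <-].
rewrite !cdf_integral_indic//.
set mP := lebesgue_stieltjes_measure P B.
set mQ := lebesgue_stieltjes_measure Q B.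
have : (mQ <= mP + (2%:E * Delta + q0%:E))%E by exact: stieltjes_le.
(* The same one-sided bound for the complement of [B], rewritten using total mass 1. *)
have : (1 - mQ <= 1 - mP + (2%:E * Delta + q0%:E))%E.
  by have := stieltjes_le (measurableC mB); rewrite !probability_setC.
(* Both masses are finite, so the two inequalities combine in real arithmetic unless the bound is
   infinite. *)
rewrite -(fineK (fin_num_measure _ _ mB) : _ = mP).
rewrite -(fineK (fin_num_measure _ _ mB) : _ = mQ).
move: (fine mP) (fine mQ) => a b.
case: (2%:E * Delta + q0%:E)%E => [e||]//= bC ba; last by rewrite leey.
rewrite lee_fin; rewrite !lee_fin in bC ba.
by rewrite ler_norml; apply/andP; split; lra.
Qed.

End SteinDiscrepancy.

Theorem theorem2p2 (R : realType) (P Q : cumulativeBounded (0 : R) (1 : R))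
    (p0 q0 : R) (cP cQ : \bar R) (p q : R -> R)
    (hP : assumption0 P p0 cP p) (hQ : assumption0 Q q0 cQ q)
    (hp0 : p0 = 0) (hc : (cP <= cQ)%E) :
  (Kol P Q <= stein_discrepancy Q cQ q P cP p + q0%:E)%E /\
  (TV P Q <= 2%:E * stein_discrepancy Q cQ q P cP p + q0%:E)%E.
Proof.
split; [exact: (Kol_bound hP hQ hc)|exact: (TV_bound hP hQ hc)].
Qed.
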